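(* Let $\lambda>0$, let $\xi\in D(S_0)$ be an eigenvector of $\Delta_0^{1/2}$ corresponding to the eigenvalue $\lambda^2$, and let $(X,D(X))$ be a densely defined, closed operator affiliated to $M$ such that $\xi_0\in D(X)\cap D(X^* )$, $\xi=X\xi_0$, $S_0(\xi)=X^*\xi_0$. Then for any $\varepsilon,\delta>0$ and any $\eta\in\tilde{\mathcal F}_X$ $$\mathcal E_X^\lambda[\eta]\ge(\lambda^2-\varepsilon^2)\|X\eta\|^2+(\lambda^2-\delta^{-2})\|XJ\eta\|^2+(\lambda^{-2}-\delta^2)\|X^*\eta\|^2+(\lambda^{-2}-\varepsilon^{-2})\|X^*J\eta\|^2.$$ In particular, for $\varepsilon=\delta=1$ and any $\eta\in\tilde{\mathcal F}_X$, $$\mathcal E_X^\lambda[\eta]\ge(\lambda^2-1)\bigl(\|X\eta\|^2+\|XJ\eta\|^2\bigr)+(\lambda^{-2}-1)\bigl(\|X^*\eta\|^2+\|X^*J\eta\|^2\bigr).$$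
   Context: $(M,L^2(M),L^2_+(M),J)$ is a standard form of a $\sigma$-finite von Neumann algebra with commutant $M'$; $\omega_0$ is a faithful normal state represented by the cyclic vector $\xi_0\in L^2_+(M)$. $S_0=J\Delta_0^{1/2}$ is the polar decomposition of the closure $S_0$ of $x\xi_0\mapsto x^*\xi_0$, $x\in M$. A densely defined closed operator $(X,D(X))$ is affiliated to $M$ if $z'D(X)\subseteq D(X)$ and $Xz'\eta=z'X\eta$ for $z'\in M'$, $\eta\in D(X)$. $j(X):=JXJ$ with domain $JD(X)$. The form $(\mathcal E_X^\lambda,\mathcal F_X^\lambda)$ is the closure of the closable form $\tilde{\mathcal E}_X^\lambda[\eta]:=\|(\lambda X-\lambda^{-1}j(X^* ))\eta\|^2+\|(\lambda^{-1}X^*-\lambda j(X))\eta\|^2$ with domain $\tilde{\mathcal F}_X:=D(X)\cap D(X^* )\cap J(D(X)\cap D(X^* ))$; the two forms coincide on $\tilde{\mathcal F}_X$. *)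

(* Defs.v *)
From HB Require Import structures.
From mathcomp Require Import all_boot all_order all_algebra sesquilinear.
From mathcomp Require Import complex.
From mathcomp Require Import all_classical all_reals all_analysis.

Set Implicit Arguments.
Unset Strict Implicit.
Unset Printing Implicit Defensive.

Import Order.TTheory GRing.Theory Num.Theory.
Import numFieldNormedType.Exports.

Local Open Scope classical_set_scope.
Local Open Scope ring_scope.

(* The inner product is linear in its first argument. *)
HB.mixin Record isHilbert (R : realType) H
    of CompleteNormedModule R[i] H := {
  hdot : {dot H for (@Num.conj R[i])} ;
  hdot_norm : forall x : H, `|x| ^+ 2 = hdot x x }.

#[short(type="hilbertType")]
HB.structure Definition Hilbert (R : realType) :=
  {H of isHilbert R H & CompleteNormedModule R[i] H}.

Notation "'[ u , v ]" := (hdot u v) : ring_scope.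

(* The norm of the normed R[i]-module H is R[i]-valued; this is its real value. *)
Definition hnorm (R : realType) (H : hilbertType R) (x : H) : R :=
  complex.Re `|x|.

Section PartialOperators.
Context {R : realType} {H : hilbertType R}.

(* The values of [opfun] outside of [dom] are irrelevant. *)
Record partial_op := PartialOp { dom : set H ; opfun :> H -> H }.
Implicit Types X Y S T : partial_op.

Definition op_eq X Y :=
  dom X = dom Y /\ forall x, dom X x -> X x = Y x.

Definition graph X : set (H * H) := [set p | dom X p.1 /\ p.2 = X p.1].

(* For a single-valued G, the operator with graph G. *)
Definition of_graph (G : set (H * H)) : partial_op :=
  PartialOp [set x | exists y, G (x, y)] (fun x => xget 0 [set y | G (x, y)]).

Definition op_closure X := of_graph (closure (graph X)).

Definition op_comp X Y :=
  PartialOp [set x | dom Y x /\ dom X (Y x)] (fun x => X (Y x)).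

Definition linear_op X :=
  dom X 0 /\ forall (a : R[i]) x y, dom X x -> dom X y ->
    dom X (a *: x + y) /\ X (a *: x + y) = a *: X x + X y.

Definition closed_op X := closed (graph X).

Definition densely_defined X := dense (dom X).

(* Single-valued as soon as X is densely defined. *)
Definition adjoint X : partial_op :=
  of_graph [set p | forall x, dom X x -> '[X x, p.1] = '[x, p.2]].

Definition positive_selfadjoint T :=
  [/\ linear_op T, densely_defined T, op_eq (adjoint T) T &
      forall x, dom T x -> 0 <= '[T x, x]].

Definition sqrt_of T Delta :=
  positive_selfadjoint T /\ op_eq (op_comp T T) Delta.

Definition eigenvector T (a : R[i]) (x : H) :=
  [/\ x != 0, dom T x & T x = a *: x].

Definition antiunitary_involution (J : H -> H) :=
  [/\ forall (a : R[i]) x y, J (a *: x + y) = (Num.conj a) *: J x + J y,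
      forall x, J (J x) = x &
      forall x y, '[J x, J y] = '[y, x]].

(* S = J T is the polar decomposition of S, when J is an anti-unitary: the
   kernel of the phase is the kernel of S. *)
Definition polar_decomposition S (J : H -> H) T :=
  [/\ positive_selfadjoint T,
      op_eq S (PartialOp (dom T) (fun x => J (T x))) &
      [set x | J x = 0] = [set x | dom S x /\ S x = 0]].

Definition bounded_op (x : H -> H) := linear x /\ continuous x.

Definition badjoint (x : H -> H) : H -> H := adjoint (PartialOp setT x).

Definition positive_bop (x : H -> H) := forall u, 0 <= '[x u, u].

Definition selfadjoint_bop (x : H -> H) := forall u v, '[x u, v] = '[u, x v].

Definition bop_le (x y : H -> H) := positive_bop (y - x).

Definition projection (p : H -> H) :=
  [/\ bounded_op p, selfadjoint_bop p & p \o p = p].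

End PartialOperators.

Section VonNeumann.
Context {R : realType} {H : hilbertType R}.
Implicit Types (M : set (H -> H)) (J : H -> H) (P : set H).

Definition commutant M : set (H -> H) :=
  [set z | bounded_op z /\ forall x, M x -> z \o x = x \o z].

(* A bicommutant is automatically a unital subalgebra of B(H). *)
Definition von_neumann_algebra M :=
  [/\ forall x, M x -> bounded_op x,
      forall x, M x -> M (badjoint x) &
      commutant (commutant M) = M].

Definition sigma_finite_vna M :=
  forall A : set (H -> H),
    (forall p, A p -> M p /\ projection p) ->
    (forall p q, A p -> A q -> p <> q -> p \o q = 0) ->
    countable A.

(* Haagerup's definition; self-duality makes P a closed convex cone. *)
Definition standard_form M P J :=
  [/\ antiunitary_involution J,
      P = [set x | forall y, P y -> 0 <= '[x, y]],
      [set J \o x \o J | x in M] = commutant M,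
      forall c, M c -> commutant M c -> J \o c \o J = badjoint c &
      (forall x, P x -> J x = x) /\
      (forall a x, M a -> P x -> P (a (J (a (J x)))))].

Definition state_on M (omega : (H -> H) -> R[i]) :=
  [/\ forall (a : R[i]) x y, M x -> M y ->
        omega (a *: x + y) = a * omega x + omega y,
      forall x, M x -> positive_bop x -> 0 <= omega x &
      omega idfun = 1].

Definition faithful_on M (omega : (H -> H) -> R[i]) :=
  forall x, M x -> omega (badjoint x \o x) = 0 -> x = 0.

(* omega preserves the suprema of the bounded upward directed families of
   self-adjoint elements of M. *)
Definition normal_on M (omega : (H -> H) -> R[i]) :=
  forall (A : set (H -> H)) (s : H -> H),
    A !=set0 ->
    (forall x, A x -> M x /\ selfadjoint_bop x) ->
    (forall x y, A x -> A y -> exists z, [/\ A z, bop_le x z & bop_le y z]) ->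
    M s -> selfadjoint_bop s ->
    (forall x, A x -> bop_le x s) ->
    (forall t, M t -> selfadjoint_bop t ->
       (forall x, A x -> bop_le x t) -> bop_le s t) ->
    complex.Re (omega s) = sup [set complex.Re (omega x) | x in A].

Definition cyclic_vector M (xi : H) := dense [set x xi | x in M].

(* S_0: the closure of x xi |-> x^* xi, x in M. *)
Definition tomita_op M (xi : H) : partial_op :=
  op_closure (of_graph [set (x xi, badjoint x xi) | x in M]).

Definition affiliated M (X : partial_op) :=
  [/\ linear_op X, densely_defined X, closed_op X &
      forall z u, commutant M z -> dom X u ->
        dom X (z u) /\ X (z u) = z (X u)].

Definition jop J (X : partial_op) : partial_op :=
  PartialOp (J @` dom X) (fun x => J (X (J x))).

End VonNeumann.

Section QuadraticForms.
Context {R : realType} {H : hilbertType R}.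

Record quad_form := QuadForm { fdom : set H ; fval :> H -> R }.

Definition form_approx (q : quad_form) (x : H) : set (nat -> H) :=
  [set u | [/\ forall n, fdom q (u n),
      u @ \oo --> x &
      forall e : R, 0 < e -> exists N : nat, forall m n : nat,
        (N <= m)%N -> (N <= n)%N -> q (u m - u n) < e]].

(* For a closable q the limit of q (u n) exists and is the same for all u in
   [form_approx q x]. *)
Definition form_closure (q : quad_form) : quad_form :=
  QuadForm [set x | form_approx q x !=set0]
    (fun x => xget 0
       [set l : R | exists2 u, form_approx q x u & q (u n) @[n --> \oo] --> l]).

Definition tform_dom (J : H -> H) (X : partial_op) : set H :=
  (dom X `&` dom (adjoint X)) `&` J @` (dom X `&` dom (adjoint X)).

Definition tform (J : H -> H) (X : partial_op) (lambda : R) : quad_form :=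
  QuadForm (tform_dom J X) (fun eta =>
    hnorm (lambda%:C%C *: X eta
           - (lambda^-1)%:C%C *: jop J (adjoint X) eta) ^+ 2
  + hnorm ((lambda^-1)%:C%C *: adjoint X eta
           - lambda%:C%C *: jop J X eta) ^+ 2).

Definition dform (J : H -> H) (X : partial_op) (lambda : R) : quad_form :=
  form_closure (tform J X lambda).

End QuadraticForms.

(* Main.v *)
Require Import Defs.
From mathcomp Require Import all_boot all_order all_algebra sesquilinear.
From mathcomp Require Import complex.
From mathcomp Require Import all_classical all_reals all_analysis.
From mathcomp Require Import ring lra.
Import Order.TTheory GRing.Theory Num.Theory.
Import numFieldNormedType.Exports.
Local Open Scope classical_set_scope.
Local Open Scope ring_scope.

(* Expanding the squares, the form splits into two terms
   |lam u - lam^-1 v|^2 = lam^2 |u|^2 + lam^-2 |v|^2 - 2 Re(u, v), and the cross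
   term is bounded by e^2 |u|^2 + e^-2 |v|^2; this is the inequality for
   [tform].  What remains is that [dform] extends [tform], i.e. closability: the
   operators lam X - lam^-1 j(X^* ) and lam^-1 X^* - lam j(X) have formal
   adjoints on D(X^* ) /\ J D(X) and D(X) /\ J D(X^* ).  These spaces are
   dense: for T affiliated to M, (1 + T^* T)^-1 has dense range inside D(T) and
   lies in M'' = M, hence commutes with j of another such operator. *)

(** * Real inner product, convergence and density in a Hilbert space *)

Section HilbertSpace.
#[local] Set Implicit Arguments.
#[local] Unset Strict Implicit.
Context {R : realType} {H : hilbertType R}.
Implicit Types (u v w : H) (a : R) (c : R[i]).

(** The underlying real inner product: being symmetric and real bilinear, it turns expanded squares
    into real arithmetic. *)
Definition rdot u v : R := complex.Re '[u, v].

Lemma hdotC u v : '[u, v] = Num.conj '[v, u].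
Proof. by rewrite (hermC hdot u v) expr0 mul1r. Qed.

Lemma hdotDl u v w : '[u + v, w] = '[u, w] + '[v, w].
Proof. exact: linearDl. Qed.

Lemma hdotZl c u w : '[c *: u, w] = c * '[u, w].
Proof. exact: linearZl_LR. Qed.

Lemma hdotZr c u w : '[u, c *: w] = Num.conj c * '[u, w].
Proof. exact: linearZr_LR. Qed.

Lemma Re_conj c : complex.Re (Num.conj c) = complex.Re c.
Proof. by case: c. Qed.

Lemma rdotC u v : rdot u v = rdot v u.
Proof. by rewrite /rdot hdotC Re_conj. Qed.

Lemma rdotDl u v w : rdot (u + v) w = rdot u w + rdot v w.
Proof. by rewrite /rdot hdotDl raddfD. Qed.

Lemma rdotZl a u w : rdot (a%:C%C *: u) w = a * rdot u w.
Proof.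
by rewrite /rdot hdotZl; case: '[u, w] => x y; rewrite /= mul0r subr0.
Qed.

Lemma rdotNl u w : rdot (- u) w = - rdot u w.
Proof. by rewrite -scaleN1r -[- 1](rmorphN1 (real_complex R)) rdotZl mulN1r. Qed.

Lemma rdotBl u v w : rdot (u - v) w = rdot u w - rdot v w.
Proof. by rewrite rdotDl rdotNl. Qed.

Lemma rdotDr u v w : rdot w (u + v) = rdot w u + rdot w v.
Proof. by rewrite !(rdotC w) rdotDl. Qed.

Lemma rdotZr a u w : rdot w (a%:C%C *: u) = a * rdot w u.
Proof. by rewrite !(rdotC w) rdotZl. Qed.

Lemma rdotBr u v w : rdot w (u - v) = rdot w u - rdot w v.
Proof. by rewrite !(rdotC w) rdotBl. Qed.

Lemma hdot_i u v : complex.Re '[u, 'i%C *: v] = complex.Im '[u, v].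
Proof. by rewrite hdotZr; case: '[u, v] => x y /=; ring. Qed.

Lemma rdot0 u : rdot u 0 = 0.
Proof. by rewrite /rdot (linear0r hdot). Qed.

Lemma normE u : `|u| = (hnorm u)%:C%C.
Proof. by rewrite /hnorm RRe_real // realE normr_ge0. Qed.

Lemma hnorm_ge0 u : 0 <= hnorm u.
Proof. by rewrite -lecR -normE normr_ge0. Qed.

Lemma hnorm_sqr u : hnorm u ^+ 2 = rdot u u.
Proof. by rewrite /rdot -hdot_norm normE -rmorphXn. Qed.

Lemma hnorm_eq0 u : hnorm u = 0 -> u = 0.
Proof. by move=> u0; apply/eqP; rewrite -normr_eq0 normE u0. Qed.

Lemma hnormD u v : hnorm (u + v) <= hnorm u + hnorm v.
Proof. by rewrite -lecR rmorphD /= -!normE ler_normD. Qed.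

Lemma hnormBC u v : hnorm (u - v) = hnorm (v - u).
Proof. by rewrite /hnorm distrC. Qed.

Lemma rdot_le u v : `|rdot u v| <= hnorm u * hnorm v.
Proof.
rewrite -ler_sqr ?nnegrE ?mulr_ge0 ?hnorm_ge0 ?normr_ge0 // real_normK ?num_real //.
rewrite exprMn !hnorm_sqr.
have q t : 0 <= rdot u u + 2 * t * rdot u v + t ^+ 2 * rdot v v.
  have : 0 <= hnorm (u + t%:C%C *: v) ^+ 2 by rewrite sqr_ge0.
  by rewrite hnorm_sqr !(rdotDl, rdotDr, rdotZl, rdotZr) (rdotC v u); nra.
have v0 : 0 <= rdot v v by rewrite -hnorm_sqr sqr_ge0.
have [vz|vn] := eqVneq (rdot v v) 0.
  have -> : v = 0 by apply: hnorm_eq0; apply/eqP; rewrite -sqrf_eq0 hnorm_sqr vz eqxx.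
  by rewrite !rdot0 mulr0 expr0n.
(* This [t] minimises the square norm of [u + t v]; nonnegativity there is the Cauchy-Schwarz
   inequality. *)
have := q (- rdot u v / rdot v v).
have -> : rdot u u + 2 * (- rdot u v / rdot v v) * rdot u v +
  (- rdot u v / rdot v v) ^+ 2 * rdot v v =
  (rdot u u * rdot v v - rdot u v ^+ 2) / rdot v v by field.
by rewrite pmulr_lge0 ?subr_ge0 // invr_gt0 lt_def vn.
Qed.

Lemma hcvgP (f : nat -> H) u : f @ \oo --> u <->
  forall e : R, 0 < e -> exists N : nat, forall n, (N <= n)%N -> hnorm (f n - u) < e.
Proof.
rewrite cvgrPdist_lt; split => [h e e0|h e e0].
  have [N _ hN] := h e%:C%C ltac:(by rewrite ltcR).
  by exists N => n Nn; rewrite hnormBC -ltcR -normE; exact: hN.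
(* Radii are elements of [R[i]]; a positive one is real, so real radii suffice. *)
have eE : e = (complex.Re e)%:C%C by rewrite RRe_real // realE ltW.
rewrite eE ltcR in e0; have [N hN] := h _ e0.
by exists N => // n /= Nn; rewrite eE normE ltcR hnormBC; exact: hN.
Qed.

Lemma hcauchy_cvg (f : nat -> H) :
  (forall e : R, 0 < e -> exists N : nat, forall m n : nat,
     (N <= m)%N -> (N <= n)%N -> hnorm (f m - f n) < e) ->
  exists u, f @ \oo --> u.
Proof.
move=> h; apply/cvg_ex; apply: cauchy_cvg; apply: cauchy_exP => e e0.
have eE : e = (complex.Re e)%:C%C by rewrite RRe_real // realE ltW.
rewrite eE ltcR in e0; have [N hN] := h _ e0.
exists (f N); exists N => // n /= Nn.
by rewrite -ball_normE /= eE normE ltcR; exact: hN.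
Qed.

Lemma closureP (A : set H) u : closure A u <->
  forall e : R, 0 < e -> exists2 v, A v & hnorm (v - u) < e.
Proof.
split=> [h e e0|h B /nbhs_ballP[e /= e0 eB]].
  have e0' : 0 < e%:C%C :> R[i] by rewrite ltcR.
  have [v [Av]] := h _ (nbhsx_ballx u _ e0').
  by rewrite -ball_normE /= normE ltcR hnormBC; exists v.
have eE : e = (complex.Re e)%:C%C by rewrite RRe_real // realE ltW.
have e0' := e0; rewrite eE ltcR in e0'; have [v Av uv] := h _ e0'.
by exists v; split => //; apply: eB; rewrite -ball_normE /= eE normE ltcR hnormBC.
Qed.

Lemma denseP (A : set H) : dense A <-> forall u, closure A u.
Proof.
split=> [dA u B|h V [u Vu] oV].
  rewrite nbhsE => -[V [oV Vu] VB].
  have [v [Vv Av]] := dA V (ex_intro _ u Vu) oV.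
  by exists v; split => //; exact: VB.
by rewrite setIC; apply: (h u); apply: open_nbhs_nbhs; split.
Qed.

Lemma closure_seq (A : set H) u (f : nat -> H) :
  (forall n, A (f n)) -> f @ \oo --> u -> closure A u.
Proof.
move=> Af /hcvgP fu; apply/closureP => e /fu[N hN].
by exists (f N) => //; exact: hN.
Qed.

Lemma rdot_continuous u : continuous (rdot u).
Proof.
move=> v; apply/cvgrPdist_lt => e e0; apply/nbhs_ballP.
have u0 : 0 < hnorm u + 1 by rewrite ltr_wpDl ?hnorm_ge0.
have d0 : 0 < e / (hnorm u + 1) by rewrite divr_gt0.
exists (e / (hnorm u + 1))%:C%C => /=; first by rewrite ltcR.
move=> w; rewrite -ball_normE /= normE ltcR ltr_pdivlMr // mulrC => vw.
rewrite -rdotBr; apply: le_lt_trans (rdot_le _ _) _; apply: le_lt_trans vw.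
by rewrite ler_wpM2r ?hnorm_ge0 // lerDl.
Qed.

Lemma rdot_closed u : closed [set v | rdot u v = 0].
Proof.
apply: (@preimage_closed _ _ (rdot u) [set 0]); first by move=> v _; exact: rdot_continuous.
exact/accessible_closed_set1/hausdorff_accessible/norm_hausdorff.
Qed.

(** The real orthogonal complement of [u] is closed, so once it contains a dense set it contains [u]
    itself. *)
Lemma dense_orth (A : set H) u : dense A ->
  (forall v, A v -> rdot u v = 0) -> u = 0.
Proof.
move=> /denseP/(_ u) Au uA; apply: hnorm_eq0; apply/eqP.
rewrite -sqrf_eq0 hnorm_sqr; apply/eqP.
by have := closureS uA Au; rewrite -(closure_id _).1 //; exact: rdot_closed.
Qed.

(* Applied to [i v], an identity between real parts on a complex subspace
   yields the identity between imaginary parts. *)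
Lemma hdot_of_rdot (A : set H) u1 u2 (f : H -> H) :
  (forall v, A v -> A ('i%C *: v) /\ f ('i%C *: v) = 'i%C *: f v) ->
  (forall v, A v -> rdot u1 v = rdot u2 (f v)) ->
  forall v, A v -> '[u1, v] = '[u2, f v].
Proof.
move=> Ai h v Av; have [Aiv fiv] := Ai v Av.
apply/eqP; rewrite eq_complex; apply/andP; split; apply/eqP; first exact: h.
by rewrite -!hdot_i -fiv; exact: h.
Qed.

End HilbertSpace.

(** Near [t = 0] the linear term dominates, so it must vanish. The test point is [- r / (1 + |p|)],
    whose denominator is never zero and is large enough to make the value negative unless
    [r = 0]. *)
Lemma quadratic_ge0_linear0 (R : realType) (r p : R) :
  (forall t, 0 <= 2 * t * r + t ^+ 2 * p) -> r = 0.
Proof.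
move=> h; have p0 : 0 < 1 + `|p| by rewrite ltr_pwDl.
have := h (- r / (1 + `|p|)).
have -> : 2 * (- r / (1 + `|p|)) * r + (- r / (1 + `|p|)) ^+ 2 * p =
  r ^+ 2 * (p - 2 * (1 + `|p|)) / (1 + `|p|) ^+ 2 by field; rewrite gt_eqF.
rewrite pmulr_lge0 ?invr_gt0 ?exprn_gt0 // nmulr_lge0 => [|].
  by move=> r2; apply/eqP; rewrite -sqrf_eq0 eq_le r2 sqr_ge0.
have := ler_norm p; have := normr_ge0 p; lra.
Qed.

(** * Closed operators: projection onto the graph, dense subspaces, Riesz representation *)

Section ClosedOperators.
#[local] Set Implicit Arguments.
#[local] Unset Strict Implicit.
Context {R : realType} {H : hilbertType R}.
Implicit Types (u v w h : H) (a : R) (c : R[i]) (T : @partial_op R H).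

Lemma hnorm_cvg (f : nat -> H) u : f @ \oo --> u ->
  (hnorm (f n) : R) @[n --> \oo] --> hnorm u.
Proof.
move=> /hcvgP fu; apply/cvgrPdist_lt => e /fu[N hN]; exists N => // n /= /hN ltfu.
rewrite distrC; apply: le_lt_trans ltfu; rewrite ler_norml; apply/andP; split.
  have := hnormD (f n) (u - f n); rewrite addrC subrK hnormBC; lra.
have := hnormD (f n - u) u; rewrite subrK; lra.
Qed.

Lemma linear_opD T u v : linear_op T -> dom T u -> dom T v ->
  dom T (u + v) /\ T (u + v) = T u + T v.
Proof. by move=> [_ lT] du dv; have := lT 1 u v du dv; rewrite !scale1r. Qed.

Lemma linear_op0 T : linear_op T -> T 0 = 0.
Proof.
move=> lT; have d0 := lT.1; have [_] := linear_opD lT d0 d0.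
by rewrite addr0 => /(congr1 (fun x => x - T 0)); rewrite addrK subrr => <-.
Qed.

Lemma linear_opZ T c u : linear_op T -> dom T u ->
  dom T (c *: u) /\ T (c *: u) = c *: T u.
Proof.
move=> lT du; have [d0 h] := lT; have := h c u 0 du d0.
by rewrite (linear_op0 lT) !addr0.
Qed.

Lemma linear_opB T u v : linear_op T -> dom T u -> dom T v ->
  dom T (u - v) /\ T (u - v) = T u - T v.
Proof.
move=> lT du dv; rewrite -(scaleN1r v) -(scaleN1r (T v)).
have [dNv TNv] := linear_opZ (-1) lT dv; rewrite -TNv; exact: linear_opD.
Qed.

Lemma closed_op_cvg T (f : nat -> H) u w : closed_op T ->
  (forall n, dom T (f n)) -> f @ \oo --> u -> (fun n => T (f n)) @ \oo --> w ->
  dom T u /\ w = T u.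
Proof.
move=> cT df fu Tfw.
have gf : \forall n \near \oo, graph T (f n, T (f n)).
  by apply: nearW => n; exact: (conj (df n) erefl).
have [//] := closed_cvg _ cT gf (u, w) (cvg_pair fu Tfw).
Qed.

(* [u] is the orthogonal projection of [(h, 0)] onto the graph of [T], found as
   a point of the graph at minimal distance; thus [u = (1 + T^* T)^-1 h]. *)
Lemma graph_projection T h : linear_op T -> closed_op T ->
  exists2 u, dom T u & forall v, dom T v -> '[h - u, v] = '[T u, T v].
Proof.
move=> lT cT.
(* The squared distance from [(u, T u)] to [(h, 0)] in the product space. *)
pose q u := hnorm (u - h) ^+ 2 + hnorm (T u) ^+ 2.
pose S := [set q u | u in dom T]; pose d := inf S.
have hS : has_inf S.
  split; first by exists (q 0), 0 => //; exact: lT.1.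
  by exists 0 => _ [u _ <-]; rewrite addr_ge0 ?sqr_ge0.
have dq u : dom T u -> d <= q u by move=> du; apply: ge_inf; [exact: hS.2|exists u].
(* Parallelogram identity: the midpoint of [u] and [v] lies in [dom T], so its value of [q] is at
   least [d]. Hence minimising sequences are Cauchy together with their images. *)
have half u v : dom T u -> dom T v ->
    hnorm (u - v) ^+ 2 + hnorm (T u - T v) ^+ 2 <= 2 * (q u - d) + 2 * (q v - d).
  move=> du dv; have [duv Tuv] := linear_opD lT du dv.
  have [dm Tm] := linear_opZ (2^-1)%:C%C lT duv.
  have := dq _ dm; rewrite /q Tm Tuv !hnorm_sqr.
  rewrite !(rdotBl, rdotBr, rdotDl, rdotDr, rdotZl, rdotZr).
  rewrite (rdotC v u) (rdotC h u) (rdotC h v) (rdotC (T v) (T u)); lra.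
have [f hf] : {f : nat -> H & forall n, dom T (f n) /\ q (f n) < d + n.+1%:R^-1}.
  apply: (@choice _ _ (fun n u => dom T u /\ q u < d + n.+1%:R^-1)) => n.
  have n0 : 0 < n.+1%:R^-1 :> R by [].
  have [_ [u du <-] qu] := inf_adherent n0 hS.
  by exists u.
have cauchy2 (e : R) : 0 < e -> exists N : nat, forall m n : nat,
    (N <= m)%N -> (N <= n)%N ->
    hnorm (f m - f n) ^+ 2 + hnorm (T (f m) - T (f n)) ^+ 2 < e ^+ 2.
  move=> e0; have e20 : 0 < e ^+ 2 / 4 by rewrite divr_gt0 ?exprn_gt0.
  have [N _ hN] := near_infty_natSinv_lt (PosNum e20).
  exists N => m n Nm Nn; apply: le_lt_trans (half _ _ (hf m).1 (hf n).1) _.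
  have hm : m.+1%:R^-1 < e ^+ 2 / 4 := hN m Nm.
  have hn : n.+1%:R^-1 < e ^+ 2 / 4 := hN n Nn.
  have arith (x y z s t E : R) : s < E / 4 -> t < E / 4 ->
    x < z + s -> y < z + t -> 2 * (x - z) + 2 * (y - z) < E by lra.
  exact: arith hm hn (hf m).2 (hf n).2.
have sqlt (x e y : R) : 0 <= x -> 0 <= y -> 0 < e -> x ^+ 2 + y ^+ 2 < e ^+ 2 -> x < e.
  move=> x0 y0 e0 h1; rewrite -ltr_sqr ?nnegrE ?(ltW e0) //.
  by apply: le_lt_trans h1; rewrite lerDl sqr_ge0.
have [u fu] : exists u, f @ \oo --> u.
  apply: hcauchy_cvg => e e0; have [N hN] := cauchy2 e e0; exists N => m n Nm Nn.
  by apply: (sqlt _ _ _ _ _ e0 (hN m n Nm Nn)); exact: hnorm_ge0.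
have [w Tfw] : exists w, (fun n => T (f n)) @ \oo --> w.
  apply: hcauchy_cvg => e e0; have [N hN] := cauchy2 e e0; exists N => m n Nm Nn.
  have := hN m n Nm Nn; rewrite addrC => /(sqlt _ _ _ _ _ e0); apply; exact: hnorm_ge0.
have [du wE] := closed_op_cvg cT (fun n => (hf n).1) fu Tfw; subst w.
have qu : q u <= d.
  have qfu : q (f n) @[n --> \oo] --> q u.
    apply: cvgD; apply: cvgM; apply: hnorm_cvg => //; apply: cvgB => //;
      exact: cvg_cst.
  have : (d + n.+1%:R^-1 : R) @[n --> \oo] --> d + 0.
    by apply: cvgD; [exact: cvg_cst|exact: cvg_harmonic].
  rewrite addr0 => dn; apply: ler_cvg_to qfu dn _.
  by apply: nearW => n; apply: ltW; exact: (hf n).2.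
exists u => //; apply: hdot_of_rdot; first by move=> v; exact: linear_opZ.
move=> v dv.
(* First variation: this is [q (u + t v) - q u], nonnegative at the minimiser [u]. *)
have var t : 0 <= 2 * t * (rdot (T u) (T v) - rdot (h - u) v)
                 + t ^+ 2 * (hnorm v ^+ 2 + hnorm (T v) ^+ 2).
  have [dtv Ttv] := linear_opZ t%:C%C lT dv.
  have [dw Tw] := linear_opD lT du dtv.
  have := le_trans qu (dq _ dw); rewrite /q Tw Ttv !hnorm_sqr.
  rewrite !(rdotBl, rdotBr, rdotDl, rdotDr, rdotZl, rdotZr).
  rewrite (rdotC v u) (rdotC h u) (rdotC v h) (rdotC (T v) (T u)); lra.
by have /eqP := quadratic_ge0_linear0 _ _ _ var; rewrite subr_eq0 => /eqP.
Qed.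

Lemma closed_zero : closed [set 0 : H].
Proof. exact/accessible_closed_set1/hausdorff_accessible/norm_hausdorff. Qed.

(** For the zero operator on a closed subspace, [graph_projection] becomes the orthogonal projection
    onto that subspace. *)
Lemma closed_op_zero (A : set H) : closed A -> closed_op (PartialOp A (fun _ : H => 0)).
Proof.
move=> cA [u w] /= guw; have clo p (B : set H) (g : H * H -> H) : continuous g ->
    closed B -> graph (PartialOp A (fun _ => 0)) `<=` g @^-1` B ->
    closure (graph (PartialOp A (fun _ => 0))) p -> B (g p).
  by move=> cg cB gB /(closureS gB); rewrite -(closure_id _).1 //; exact: preimage_closed.
split => /=.
  by apply: (clo _ _ fst) guw => // [p|p []//]; exact: cvg_fst.
suff : [set (0 : H)] w by [].
apply: (clo _ _ snd) guw => [p| |p []//]; first exact: cvg_snd.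
exact: closed_zero.
Qed.

(** The first hypothesis encodes that [A] is a linear subspace. Projecting any [h] onto the closure
    of [A] leaves a remainder orthogonal to [A], hence zero. *)
Lemma orth_dense (A : set H) : linear_op (PartialOp A (fun _ : H => 0)) ->
  (forall u, (forall v, A v -> '[u, v] = 0) -> u = 0) -> dense A.
Proof.
move=> lA A0.
have seqA u : closure A u -> exists2 f : nat -> H, (forall n, A (f n)) & f @ \oo --> u.
  move=> /closureP cu.
  have [f hf] : {f : nat -> H & forall n, A (f n) /\ hnorm (f n - u) < n.+1%:R^-1}.
    apply: (@choice _ _ (fun n v => A v /\ hnorm (v - u) < n.+1%:R^-1)) => n.
    have n0 : 0 < n.+1%:R^-1 :> R by [].
    by have [v Av vu] := cu _ n0; exists v.
  exists f; first by move=> n; exact: (hf n).1.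
  apply/hcvgP => e e0; have [N _ hN] := near_infty_natSinv_lt (PosNum e0).
  by exists N => n Nn; apply: lt_trans (hf n).2 _; exact: hN.
have lcA : linear_op (PartialOp (closure A) (fun _ : H => 0)).
  split; first exact/subset_closure/lA.1.
  move=> c u v /seqA[f Af fu] /seqA[g Ag gv]; split; last by rewrite scaler0 addr0.
  apply: (@closure_seq _ _ _ _ (fun n => c *: f n + g n)).
    by move=> n; have [] := lA.2 c _ _ (Af n) (Ag n).
  by apply: cvgD => //; apply: cvgZ => //; exact: cvg_cst.
apply/denseP => h.
have [u /= cu hu] := graph_projection h lcA (closed_op_zero (@closed_closure _ A)).
suff /eqP : h - u = 0 by rewrite subr_eq0 => /eqP ->.
apply: A0 => v Av; rewrite hu; last exact: subset_closure.
by rewrite (linear0r hdot).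
Qed.

(** If [f h] is nonzero, the remainder [e] of [h] after projection onto the closed kernel is
    orthogonal to that kernel, and every vector is a multiple of [e] plus a kernel vector. *)
Lemma riesz (f : H -> R[i]) : (forall c u v, f (c *: u + v) = c * f u + f v) ->
  closed [set u | f u = 0] -> exists w, forall u, f u = '[u, w].
Proof.
move=> lf cf.
have f0 : f 0 = 0.
  by have := lf 1 0 0; rewrite scale1r addr0 mul1r => /(congr1 (fun x => x - f 0));
     rewrite addrK subrr => <-.
have fZ c u : f (c *: u) = c * f u by rewrite -[c *: u]addr0 lf f0 addr0.
have fB u v : f (u - v) = f u - f v by rewrite addrC -scaleN1r lf mulN1r addrC.
have [[h fh]|] := pselect (exists h, f h != 0); last first.
  move=> /forallNP nf; exists 0 => u; rewrite (linear0r hdot).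
  by apply/eqP/negPn/negP; exact: nf.
have lK : linear_op (PartialOp [set u | f u = 0] (fun _ : H => 0)).
  split=> // c u v /= fu fv; split; last by rewrite scaler0 addr0.
  by rewrite lf fu fv mulr0 addr0.
have [u /= fu hu] := graph_projection h lK (closed_op_zero cf).
set e := h - u; have fe : f e = f h by rewrite fB fu subr0.
have eK v : f v = 0 -> '[v, e] = 0.
  by move=> fv; rewrite hdotC hu // (linear0r hdot) rmorph0.
have ee : '[e, e] != 0.
  apply: contra fh; rewrite -hdot_norm expf_eq0 /= normr_eq0 => /eqP e0.
  by rewrite -fe e0 f0.
(* The scalar is conjugated because the inner product is conjugate linear in its second argument. *)
exists (Num.conj (f e / '[e, e]) *: e) => v.
have := eK (v - (f v / f e) *: e); rewrite fB fZ divfK ?fe // subrr => /(_ erefl).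
rewrite hdotZr conjCK -scaleNr addrC hdotDl hdotZl mulNr => /eqP.
rewrite addrC subr_eq0 => /eqP ->.
by field; rewrite fh ee.
Qed.
End ClosedOperators.

(** * Adjoints, affiliated operators and density of their domains *)

Section VonNeumann.
#[local] Set Implicit Arguments.
#[local] Unset Strict Implicit.
Context {R : realType} {H : hilbertType R}.
Implicit Types (u v w h : H) (a : R) (c : R[i]) (X Y T : @partial_op R H).
Implicit Types (M : set (H -> H)) (J : H -> H).

Lemma hdot_adjoint X u v : dom (adjoint X) v -> dom X u ->
  '[X u, v] = '[u, adjoint X v].
Proof.
move=> [w hw] du; rewrite /adjoint /=.
case: xgetP => [y _ hy|/(_ w) //]; exact: hy.
Qed.

Lemma rdot_adjoint X u v : dom (adjoint X) v -> dom X u ->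
  rdot (X u) v = rdot u (adjoint X v).
Proof. by move=> dv du; rewrite /rdot hdot_adjoint. Qed.

(** Real parts suffice because [dom X] is a complex subspace; its density leaves [w] as the only
    possible value of the adjoint. *)
Lemma adjoint_intro X v w : linear_op X -> densely_defined X ->
  (forall u, dom X u -> rdot (X u) v = rdot u w) ->
  dom (adjoint X) v /\ adjoint X v = w.
Proof.
move=> lX dX vw.
have d : dom (adjoint X) v.
  exists w => u du /=; rewrite hdotC [RHS]hdotC; congr Num.conj.
  apply/esym; apply: (@hdot_of_rdot _ _ (dom X)) => // [x|x dx]; first exact: linear_opZ.
  by rewrite rdotC -vw // rdotC.
split=> //; apply/eqP; rewrite -subr_eq0; apply/eqP; apply: (dense_orth dX) => u du.
by rewrite rdotBl rdotC -rdot_adjoint // vw // rdotC subrr.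
Qed.

Lemma adjoint_linear X : linear_op X -> densely_defined X -> linear_op (adjoint X).
Proof.
move=> lX dX; split=> [|c u v du dv].
  by apply: (proj1 (@adjoint_intro X 0 0 lX dX _)) => u _; rewrite !rdot0.
apply: adjoint_intro => // w dw.
rewrite !rdotDr -(rdot_adjoint dv) //; congr (_ + _).
by rewrite /rdot !hdotZr hdot_adjoint.
Qed.

Lemma adjoint_closed X : linear_op X -> densely_defined X -> closed_op (adjoint X).
Proof.
move=> lX dX -[v w] vw.
have [dv E] : dom (adjoint X) v /\ adjoint X v = w; last by [].
(* For fixed [u], the adjoint relation is the vanishing of a continuous function of [(v, w)], so it
   passes to the closure of the graph. *)
apply: adjoint_intro => // u du.
pose g (p : H * H) := rdot (X u) p.1 - rdot u p.2.
have cg : continuous g.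
  move=> p; apply: cvgB.
    by apply: cvg_comp; [exact: cvg_fst|exact: rdot_continuous].
  by apply: cvg_comp; [exact: cvg_snd|exact: rdot_continuous].
have g0 : graph (adjoint X) `<=` g @^-1` [set 0].
  by move=> [p _] [/= dp ->]; rewrite /g /= rdot_adjoint // subrr.
have := closureS g0 vw; rewrite -(closure_id _).1.
  by move/eqP; rewrite /g subr_eq0 => /eqP.
apply: preimage_closed => [p _|]; first exact: cg.
exact/accessible_closed_set1/hausdorff_accessible/norm_hausdorff.
Qed.

Lemma badjointE (x : H -> H) u v : bounded_op x -> '[x u, v] = '[u, badjoint x v].
Proof.
move=> [lx cx]; apply: (@hdot_adjoint (PartialOp setT x)) => //.
have [w hw] : exists w, forall u, '[x u, v] = '[u, w]; last by exists w => u' _; exact: hw.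
apply: (@riesz R H (fun u => '[x u, v])) => [c u1 u2|]; first by rewrite lx hdotDl hdotZl.
(* The complex kernel is cut out by the real and imaginary parts, each a closed condition. *)
have -> : [set u | '[x u, v] = 0] =
    x @^-1` [set w | rdot v w = 0] `&` x @^-1` [set w | rdot ('i%C *: v) w = 0].
  apply/seteqP; split=> [w /= xw|w /= []].
    by split; rewrite /= rdotC /rdot ?hdot_i xw.
  rewrite !(rdotC _ (x w)) /rdot hdot_i => r0 i0.
  by apply/eqP; rewrite eq_complex r0 i0 eqxx.
by apply: closedI; apply: preimage_closed => [w _|];
  [exact: cx|exact: rdot_closed|exact: cx|exact: rdot_closed].
Qed.

Section Antiunitary.
Context {J : H -> H} (hJ : antiunitary_involution J).

Lemma antiunitaryK u : J (J u) = u. Proof. by case: hJ. Qed.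

Lemma antiunitary_dot u v : '[J u, v] = '[J v, u].
Proof. by case: hJ => _ JK Jd; rewrite -{1}[v]JK Jd. Qed.

Lemma antiunitary_rdot u v : rdot (J u) v = rdot u (J v).
Proof. by rewrite /rdot antiunitary_dot -/(rdot _ _) rdotC. Qed.

Lemma antiunitary_norm u : hnorm (J u) = hnorm u.
Proof.
apply/eqP; rewrite -(@eqrXn2 _ 2) ?hnorm_ge0 // !hnorm_sqr.
by rewrite antiunitary_rdot antiunitaryK.
Qed.

Lemma antiunitaryP c u v : J (c *: u + v) = Num.conj c *: J u + J v.
Proof. by case: hJ => Jl _ _; exact: Jl. Qed.

Lemma antiunitaryB u v : J (u - v) = J u - J v.
Proof. by rewrite addrC -scaleN1r antiunitaryP rmorphN1 scaleN1r addrC. Qed.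

End Antiunitary.

Lemma bounded_continuous (A : H -> H) : (forall u v, A (u - v) = A u - A v) ->
  (forall u, hnorm (A u) <= hnorm u) -> continuous A.
Proof.
move=> AB Ale u; apply/cvgrPdist_lt => e e0; apply/nbhs_ballP; exists e => // v.
rewrite -ball_normE /= -AB !normE; apply: le_lt_trans; by rewrite lecR.
Qed.

Lemma antiunitary_continuous J : antiunitary_involution J -> continuous J.
Proof.
move=> hJ; apply: bounded_continuous => [u v|u]; first exact: antiunitaryB.
by rewrite antiunitary_norm.
Qed.

Lemma dense_range_comp (A B : H -> H) : continuous A ->
  dense (range A) -> dense (range B) -> dense (range (A \o B)).
Proof.
move=> cA dA dB V V0 oV.
have [y [Vu [u _ E]]] := dA V V0 oV; subst y.
have oAV : open (A @^-1` V) by apply: open_comp => // w _; exact: cA.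
have [y [VAw [w _ E]]] := dB _ (ex_intro _ u Vu) oAV; subst y.
by exists (A (B w)); split => //; exists w.
Qed.

(** Every [z] in the commutant is [J x J] with [x] in [M], and its adjoint is [J] times the adjoint
    of [x] times [J]. *)
Lemma commutant_star M P J z : von_neumann_algebra M -> standard_form M P J ->
  commutant M z ->
  exists2 z', commutant M z' & forall u v, '[z u, v] = '[u, z' v].
Proof.
move=> [bM sM _] [hJ _ JMJ _ _]; rewrite -JMJ => -[x Mx <-].
exists (J \o badjoint x \o J); first by exists (badjoint x) => //; exact: sM.
move=> u v /=; rewrite (antiunitary_dot hJ) hdotC badjointE; last exact: bM.
by rewrite [RHS]hdotC [in RHS](antiunitary_dot hJ).
Qed.

Lemma linear_fun_sub (f : H -> H) : linear f -> {morph f : u v / u - v}.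
Proof. by move=> lf u v; rewrite addrC -scaleN1r lf scaleN1r addrC. Qed.

(** [A] is (1 + T^* T)^-1, selected through [graph_projection]. Uniqueness of the solution of its
    defining equation gives both linearity and commutation with the commutant. *)
Lemma affiliated_resolvent M T :
  (forall z, commutant M z -> exists2 z', commutant M z' &
    forall u v, '[z u, v] = '[u, z' v]) ->
  affiliated M T ->
  exists2 A, commutant (commutant M) A &
    (forall u, dom T (A u)) /\ dense (range A).
Proof.
move=> star [lT dT cT comm].
have [A hA] : {A : H -> H & forall h, dom T (A h) /\
    forall v, dom T v -> '[h - A h, v] = '[T (A h), T v]}.
  apply: (@choice _ _ (fun h u => dom T u /\
    forall v, dom T v -> '[h - u, v] = '[T u, T v])) => h.
  by have [u du hu] := graph_projection h lT cT; exists u.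
have Auniq h u : dom T u -> (forall v, dom T v -> '[h - u, v] = '[T u, T v]) -> A h = u.
  move=> du hu; have [dA hAh] := hA h.
  have [dd Td] := linear_opB lT dA du.
  apply/eqP; rewrite -subr_eq0; apply/eqP; apply: hnorm_eq0; apply/eqP.
  (* Both candidates solve the equation; subtract the two and test on their difference. *)
  have : hnorm (A h - u) ^+ 2 + hnorm (T (A h - u)) ^+ 2 = 0.
    have -> : hnorm (A h - u) ^+ 2 = rdot (h - u) (A h - u) - rdot (h - A h) (A h - u).
      by rewrite hnorm_sqr -rdotBl opprB [_ + (A h - h)]addrC addrA subrK.
    rewrite /rdot hu // hAh // -!/(rdot _ _) hnorm_sqr Td rdotBl; ring.
  move=> /eqP; rewrite paddr_eq0 ?sqr_ge0 // => /andP[]; by rewrite sqrf_eq0.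
have Alin : linear A.
  move=> c u v; have [du hu] := hA u; have [dv hv] := hA v.
  have [d0 hl] := lT; have [dw Tw] := hl c _ _ du dv.
  apply: Auniq => // w dw'; rewrite Tw.
  by rewrite opprD addrACA -scalerBr hdotDl hdotZl hu // hv // hdotDl hdotZl.
have A2 h : hnorm (A h) ^+ 2 + hnorm (T (A h)) ^+ 2 = rdot h (A h).
  have [dh hh] := hA h; rewrite !hnorm_sqr.
  have -> : rdot (T (A h)) (T (A h)) = rdot (h - A h) (A h) by rewrite /rdot hh.
  by rewrite rdotBl addrC subrK.
have Ale h : hnorm (A h) <= hnorm h.
  have := A2 h; have := ler_norm (rdot h (A h)); have := rdot_le h (A h).
  have := hnorm_ge0 h; have := hnorm_ge0 (A h); have := sqr_ge0 (hnorm (T (A h))).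
  move=> t0 a0 h0 h1 h2 h3; rewrite leNgt; apply/negP => lt.
  have : hnorm h * hnorm (A h) < hnorm (A h) ^+ 2.
    by rewrite expr2 ltr_pM2r // (le_lt_trans h0).
  lra.
have AB := linear_fun_sub Alin.
exists A; last first.
  split=> [u|]; first exact: (hA u).1.
  apply: orth_dense.
    split; first by exists 0 => //; have := AB 0 0; rewrite !subrr.
    move=> c _ _ [u _ <-] [v _ <-]; split; last by rewrite scaler0 addr0.
    by exists (c *: u + v); rewrite // Alin.
  (* If [h] is orthogonal to the range, then [(h, A h) = 0] forces [A h] and [T (A h)] to vanish,
     and the defining equation makes [h] orthogonal to the dense [dom T]. *)
  move=> h hh; have := A2 h; rewrite /rdot hh /=; last by exists h.
  move=> /eqP; rewrite paddr_eq0 ?sqr_ge0 // !sqrf_eq0.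
  move=> /andP[/eqP /hnorm_eq0 Ah /eqP /hnorm_eq0 TAh].
  apply: (dense_orth dT) => v dv; have := (hA h).2 v dv.
  by rewrite TAh Ah subr0 /rdot => ->; rewrite (linear0l hdot).
split; first by split=> //; exact: bounded_continuous.
move=> z cz; apply/funext => h /=.
have [z' cz' zz'] := star z cz.
have [du hu] := hA h; have [dz Tz] := comm z _ cz du.
(* The vector [z (A h)] solves the equation that defines [A (z h)]: move [z] across as [z'], which
   commutes with [T]. *)
apply: Auniq => // v dv; have [dz' Tz'] := comm z' v cz' dv.
have [[lz _] _] := cz.
have -> : z h - z (A h) = z (h - A h).
  by rewrite (linear_fun_sub lz).
by rewrite zz' hu // Tz' -zz' Tz.
Qed.

(** Density is the main point: the domain of the adjoint is stable under the commutant and contains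
    [xi0], hence all [J x J xi0 = J (x xi0)] with [x] in [M]. These are dense, as [xi0] is cyclic
    and [J] is a homeomorphism. *)
Lemma adjoint_affiliated M P J X xi0 : von_neumann_algebra M -> standard_form M P J ->
  P xi0 -> cyclic_vector M xi0 -> affiliated M X -> dom (adjoint X) xi0 ->
  affiliated M (adjoint X).
Proof.
move=> vM sM Pxi0 cyc [lX dX cX comm] dxi0.
have star z := @commutant_star M P J z vM sM.
have comm' z u : commutant M z -> dom (adjoint X) u ->
    dom (adjoint X) (z u) /\ adjoint X (z u) = z (adjoint X u).
  move=> cz du; apply: adjoint_intro => // v dv.
  have [z' cz' zz'] := star z cz; have [dz' Tz'] := comm z' v cz' dv.
  by rewrite rdotC /rdot zz' -Tz' -/(rdot _ _) rdotC rdot_adjoint // rdotC /rdot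
    -zz' -/(rdot _ _) rdotC.
split=> //; [exact: adjoint_linear| |exact: adjoint_closed].
have [hJ _ JMJ _ [Jfix _]] := sM.
move=> V [u Vu] oV.
have oJV : open (J @^-1` V).
  by apply: open_comp => // w _; exact: antiunitary_continuous.
have JVu : (J @^-1` V) (J u) by rewrite /preimage /= antiunitaryK.
have [y [VJx [x Mx E]]] := cyc _ (ex_intro _ _ JVu) oJV; subst y.
exists (J (x xi0)); split=> //.
have cz : commutant M (J \o x \o J) by rewrite -JMJ; exists x.
by have [+ _] := comm' _ _ cz dxi0; rewrite /= (Jfix xi0).
Qed.

(* The range of the product of a resolvent of [X] with the [j]-image of one of
   [Y]; these commute, being in [M] and [M']. *)
Lemma affiliated_dom_dense M P J X Y : von_neumann_algebra M -> standard_form M P J ->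
  affiliated M X -> affiliated M Y -> dense (dom X `&` J @` dom Y).
Proof.
move=> vM sM aX aY.
have star z := @commutant_star M P J z vM sM.
have [A cA [domA dA]] := affiliated_resolvent star aX.
have [B cB [domB dB]] := affiliated_resolvent star aY.
have [_ _ bic] := vM; have [hJ _ JMJ _ _] := sM.
have MB : M B by rewrite -bic.
have cJ := antiunitary_continuous hJ.
have dJ : dense (range J).
  by move=> V [u Vu] _; exists u; split=> //; exists (J u) => //; rewrite antiunitaryK.
have cJBJ : commutant M (J \o B \o J) by rewrite -JMJ; exists B.
have [[_ contA] commA] := cA.
have dd : dense (range (A \o (J \o B \o J))).
  apply: dense_range_comp => //; rewrite -compA; apply: dense_range_comp => //.
  by apply: dense_range_comp => //; have [[_ ?] _] := cB.
move=> V V0 oV; have [y [Vx [w _ E]]] := dd V V0 oV; subst y.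
exists ((A \o (J \o B \o J)) w); split=> //; split; first exact: domA.
(* Written in the other order, the same vector is [J (B (J (A w)))], which lies in [J] of
   [dom Y]. *)
rewrite (commA _ cJBJ) /=; exists (B (J (A w))) => //.
Qed.

End VonNeumann.

(** * Lower bound and closability of the quadratic form *)

Section QuadraticForm.
#[local] Set Implicit Arguments.
#[local] Unset Strict Implicit.
Context {R : realType} {H : hilbertType R}.
Implicit Types (u v w h : H) (a : R) (c : R[i]) (X Y : @partial_op R H).

(** By completeness [F (f n)] has a limit [w]. Pairing with [z] in [Z] and moving [F] across as [G]
    shows that [w] and [F u] agree on the dense set [Z]. *)
Lemma formal_adjoint_closable (E Z : set H) (F G : H -> H) (f : nat -> H) u :
  dense Z -> (forall v z, E v -> Z z -> rdot (F v) z = rdot v (G z)) ->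
  E u -> (forall n, E (f n)) -> f @ \oo --> u ->
  (forall e : R, 0 < e -> exists N : nat, forall m n : nat,
     (N <= m)%N -> (N <= n)%N -> hnorm (F (f m) - F (f n)) < e) ->
  F (f n) @[n --> \oo] --> F u.
Proof.
move=> dZ FG Eu Ef fu /(hcauchy_cvg (f := F \o f))[w Fw].
suff -> : F u = w by [].
apply/eqP; rewrite -subr_eq0; apply/eqP; apply: (dense_orth dZ) => z Zz.
rewrite rdotBl; apply/eqP; rewrite subr_eq0; apply/eqP.
rewrite FG //.
have h1 : rdot z (F (f n)) @[n --> \oo] --> rdot z w.
  by apply: continuous_cvg; [exact: rdot_continuous|exact: Fw].
have h2 : rdot (G z) (f n) @[n --> \oo] --> rdot (G z) u.
  by apply: continuous_cvg; [exact: rdot_continuous|exact: fu].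
have E12 : (fun n => rdot z (F (f n))) = (fun n => rdot (G z) (f n)).
  by apply/funext => n; rewrite rdotC FG // rdotC.
rewrite E12 in h1; rewrite rdotC [RHS]rdotC.
by apply: (cvg_unique _ h2 h1); exact: norm_hausdorff.
Qed.

(** The cross term [2 (u, v)] does not depend on the scaling parameter, so the two sides differ
    exactly by the square norm of [e u - e^-1 v]. *)
Lemma norm_sub_lower (lam e : R) u v : 0 < lam -> 0 < e ->
  (lam ^+ 2 - e ^+ 2) * hnorm u ^+ 2 + (lam ^- 2 - e ^- 2) * hnorm v ^+ 2 <=
  hnorm (lam%:C%C *: u - (lam^-1)%:C%C *: v) ^+ 2.
Proof.
have sq s : 0 < s -> hnorm (s%:C%C *: u - (s^-1)%:C%C *: v) ^+ 2 =
    s ^+ 2 * hnorm u ^+ 2 - 2 * rdot u v + s ^- 2 * hnorm v ^+ 2.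
  move=> s0; rewrite !hnorm_sqr !(rdotBl, rdotBr, rdotZl, rdotZr) (rdotC v u).
  by field; rewrite gt_eqF.
move=> lam0 e0; have := sqr_ge0 (hnorm (e%:C%C *: u - (e^-1)%:C%C *: v)).
rewrite !sq //; lra.
Qed.

Section TensorForm.
Context {J : H -> H} (hJ : antiunitary_involution J).

Lemma tform_domP X u : tform_dom J X u <->
  [/\ dom X u, dom (adjoint X) u, dom X (J u) & dom (adjoint X) (J u)].
Proof.
split=> [[[du du'] [w [dw dw'] E]]|[du du' dj dj']].
  by subst u; split=> //; rewrite (antiunitaryK hJ).
by split=> //; exists (J u) => //; rewrite (antiunitaryK hJ).
Qed.

Lemma jop_rdot X Y u v :
  (forall u v, dom Y u -> dom X v -> rdot (Y u) v = rdot u (X v)) ->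
  dom Y (J u) -> dom X (J v) -> rdot (jop J Y u) v = rdot u (jop J X v).
Proof.
by move=> YX du dv; rewrite /jop /= (antiunitary_rdot hJ) YX // (antiunitary_rdot hJ).
Qed.

Lemma jopB X u v : linear_op X -> dom X (J u) -> dom X (J v) ->
  jop J X (u - v) = jop J X u - jop J X v.
Proof.
move=> lX du dv; rewrite /jop /= (antiunitaryB hJ).
by have [_ ->] := linear_opB lX du dv; rewrite (antiunitaryB hJ).
Qed.

(** One shape for both halves of the form: [Y = adjoint X] gives the first; exchanging [X] with its
    adjoint and [lam] with its inverse gives the second. *)
Definition form_part (lam : R) X Y u : H :=
  lam%:C%C *: X u - (lam^-1)%:C%C *: jop J Y u.

Lemma form_partB lam X Y u v : linear_op X -> linear_op Y ->
  dom X u -> dom X v -> dom Y (J u) -> dom Y (J v) ->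
  form_part lam X Y (u - v) = form_part lam X Y u - form_part lam X Y v.
Proof.
move=> lX lY du dv du' dv'; rewrite /form_part jopB //.
have [_ ->] := linear_opB lX du dv.
by rewrite !scalerBr !opprB addrACA [RHS]addrACA [- _ + _ in RHS]addrC.
Qed.

Lemma form_part_rdot lam X Y X' Y' u v :
  (forall u v, dom X u -> dom X' v -> rdot (X u) v = rdot u (X' v)) ->
  (forall u v, dom Y u -> dom Y' v -> rdot (Y u) v = rdot u (Y' v)) ->
  dom X u -> dom Y (J u) -> dom X' v -> dom Y' (J v) ->
  rdot (form_part lam X Y u) v = rdot u (form_part lam X' Y' v).
Proof.
move=> XX YY du du' dv dv'; rewrite /form_part rdotBl rdotBr !rdotZl !rdotZr.
by rewrite XX // (jop_rdot YY).
Qed.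

Lemma tformE X lam u : tform J X lam u =
  hnorm (form_part lam X (adjoint X) u) ^+ 2 +
  hnorm (form_part lam^-1 (adjoint X) X u) ^+ 2.
Proof. by rewrite /form_part invrK. Qed.

(** Closability: by [d1] and [d2] both halves have densely defined formal adjoints, so along every
    approximating sequence the form converges to its value at [u]. *)
Lemma dform_tform X lam u : linear_op X -> densely_defined X ->
  dense (dom (adjoint X) `&` J @` dom X) -> dense (dom X `&` J @` dom (adjoint X)) ->
  tform_dom J X u -> dform J X lam u = tform J X lam u.
Proof.
move=> lX dX d1 d2 tu; have lX' := adjoint_linear lX dX.
pose F := form_part lam X (adjoint X); pose F' := form_part lam^-1 (adjoint X) X.
have tE v : tform J X lam v = hnorm (F v) ^+ 2 + hnorm (F' v) ^+ 2 by exact: tformE.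
have FB v w : tform_dom J X v -> tform_dom J X w -> F (v - w) = F v - F w.
  by move=> /tform_domP[? ? ? ?] /tform_domP[? ? ? ?]; exact: form_partB.
have FB' v w : tform_dom J X v -> tform_dom J X w -> F' (v - w) = F' v - F' w.
  by move=> /tform_domP[? ? ? ?] /tform_domP[? ? ? ?]; exact: form_partB.
have lim f : form_approx (tform J X lam) u f ->
    tform J X lam (f n) @[n --> \oo] --> tform J X lam u.
  move=> [df' fu cf]; have df n : tform_dom J X (f n) := df' n.
  have adj v w : dom X v -> dom (adjoint X) w -> rdot (X v) w = rdot v (adjoint X w).
    by move=> dv dw; rewrite rdot_adjoint.
  have adj' v w : dom (adjoint X) v -> dom X w -> rdot (adjoint X v) w = rdot v (X w).
    by move=> dv dw; rewrite rdotC -adj // rdotC.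
  have cauchy e : 0 < e -> exists N : nat, forall m n : nat,
      (N <= m)%N -> (N <= n)%N ->
      hnorm (F (f m) - F (f n)) < e /\ hnorm (F' (f m) - F' (f n)) < e.
    move=> e0; have [N hN] := cf _ (exprn_gt0 2 e0); exists N => m n Nm Nn.
    have := hN m n Nm Nn; rewrite tE FB // FB' // => h.
    by split; rewrite -ltr_sqr ?nnegrE ?hnorm_ge0 ?(ltW e0) //; apply: le_lt_trans h;
       rewrite ?lerDl ?lerDr sqr_ge0.
  have cF : F (f n) @[n --> \oo] --> F u.
    apply: (formal_adjoint_closable (E := tform_dom J X)
      (G := form_part lam (adjoint X) X) d1) => //.
      move=> v z /tform_domP[? ? ? ?] [? [z' ? ?]]; apply: form_part_rdot => //.
      by subst z; rewrite (antiunitaryK hJ).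
    by move=> e /cauchy[N hN]; exists N => m n Nm Nn; exact: (hN m n Nm Nn).1.
  have cF' : F' (f n) @[n --> \oo] --> F' u.
    apply: (formal_adjoint_closable (E := tform_dom J X)
      (G := form_part lam^-1 X (adjoint X)) d2) => //.
      move=> v z /tform_domP[? ? ? ?] [? [z' ? ?]]; apply: form_part_rdot => //.
      by subst z; rewrite (antiunitaryK hJ).
    by move=> e /cauchy[N hN]; exists N => m n Nm Nn; exact: (hN m n Nm Nn).2.
  under eq_fun do rewrite tE; rewrite tE.
  by apply: cvgD; apply: cvgM; exact: hnorm_cvg.
(* The constant sequence shows that a limit exists, so [xget] does not fall back on its default [0];
   by [lim] any limit it picks is the right one. *)
have appr : form_approx (tform J X lam) u (fun=> u).
  split=> //; first exact: cvg_cst.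
  move=> e e0; exists 0%N => m n _ _; rewrite tE FB // FB' // !subrr.
  by rewrite !hnorm_sqr !rdot0 addr0.
rewrite /dform /form_closure /=; case: xgetP => [l _ [f af fl]|/(_ (tform J X lam u)) []].
  by apply: (cvg_unique _ fl (lim f af)); exact: norm_hausdorff.
by exists (fun=> u) => //; exact: lim.
Qed.

End TensorForm.
End QuadraticForm.

(** * Combination of the bounds for the two halves of the form *)

Theorem corollary3p2 (R : realType) (H : hilbertType R)
  (M : set (H -> H)) (L2plus : set H) (J : H -> H)
  (hM : von_neumann_algebra M) (hsigma : sigma_finite_vna M)
  (hstd : standard_form M L2plus J)
  (omega0 : (H -> H) -> R[i]) (homega0 : state_on M omega0)
  (hfaithful : faithful_on M omega0) (hnormal : normal_on M omega0)
  (xi0 : H) (hxi0 : L2plus xi0) (hcyclic : cyclic_vector M xi0)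
  (hrepr : forall x : H -> H, M x -> omega0 x = '[x xi0, xi0])
  (Delta0 sqrtDelta0 : @partial_op R H)
  (hsqrt : sqrt_of sqrtDelta0 Delta0)
  (hpolar : polar_decomposition (tomita_op M xi0) J sqrtDelta0)
  (lambda : R) (hlambda : 0 < lambda)
  (xi : H) (hxi : dom (tomita_op M xi0) xi)
  (heigen : eigenvector sqrtDelta0 (lambda ^+ 2)%:C%C xi)
  (X : @partial_op R H) (hX : affiliated M X)
  (hX0 : (dom X `&` dom (adjoint X)) xi0)
  (hxiX : xi = X xi0) (hSxi : tomita_op M xi0 xi = adjoint X xi0) :
  (forall (eps delta : R) (eta : H), 0 < eps -> 0 < delta ->
     tform_dom J X eta ->
     dform J X lambda eta >=
       (lambda ^+ 2 - eps ^+ 2) * hnorm (X eta) ^+ 2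
     + (lambda ^+ 2 - delta ^- 2) * hnorm (X (J eta)) ^+ 2
     + (lambda ^- 2 - delta ^+ 2) * hnorm (adjoint X eta) ^+ 2
     + (lambda ^- 2 - eps ^- 2) * hnorm (adjoint X (J eta)) ^+ 2) /\
  (forall eta : H, tform_dom J X eta ->
     dform J X lambda eta >=
       (lambda ^+ 2 - 1) * (hnorm (X eta) ^+ 2 + hnorm (X (J eta)) ^+ 2)
     + (lambda ^- 2 - 1) *
       (hnorm (adjoint X eta) ^+ 2 + hnorm (adjoint X (J eta)) ^+ 2)).
Proof.
have [hJ _ _ _ _] := hstd; have [lX dX _ _] := hX.
have hX' := adjoint_affiliated hM hstd hxi0 hcyclic hX hX0.2.
have bound eps delta eta : 0 < eps -> 0 < delta -> tform_dom J X eta ->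
    dform J X lambda eta >=
      (lambda ^+ 2 - eps ^+ 2) * hnorm (X eta) ^+ 2
    + (lambda ^+ 2 - delta ^- 2) * hnorm (X (J eta)) ^+ 2
    + (lambda ^- 2 - delta ^+ 2) * hnorm (adjoint X eta) ^+ 2
    + (lambda ^- 2 - eps ^- 2) * hnorm (adjoint X (J eta)) ^+ 2.
  move=> eps0 delta0 teta; rewrite (dform_tform hJ) //; last 2 first.
  - exact: affiliated_dom_dense hM hstd hX' hX.
  - exact: affiliated_dom_dense hM hstd hX hX'.
  rewrite tformE.
  (* The first half is bounded with parameter [eps]; the second, where the scaling is [lambda^-1],
     with [delta]. Since [J] is isometric, [j(Y) eta] has the norm of [Y (J eta)]. *)
  have := norm_sub_lower (X eta) (jop J (adjoint X) eta) hlambda eps0.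
  have li0 : 0 < lambda^-1 by rewrite invr_gt0.
  have := norm_sub_lower (adjoint X eta) (jop J X eta) li0 delta0.
  rewrite -!/(form_part _ _ _ _) ![hnorm (jop _ _ _)](antiunitary_norm hJ).
  rewrite !exprVn invrK => h1 h2; apply: le_trans (lerD h2 h1); lra.
split=> // eta teta; apply: le_trans (bound 1 1 eta ltr01 ltr01 teta).
by rewrite expr1n invr1; lra.
Qed.
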